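(* Let $H_i:[0,T]\times\mathbb{R}^n\times\mathbb{R}^n\to\mathbb{R}$, $i\in\mathbb{N}\cup\{0\}$, be continuous in all variables and convex in the last variable, and let $\mathsf{e}_i:[0,T]\times\mathbb{R}^n\times\mathbb{R}^{n+1}\to\mathbb{R}^{n+1}$ be defined by $\mathsf{e}_i(t,x,a)=s_{n+1}(\Phi_i(t,x,a))$, where $\Phi_i(t,x,a)=E_i(t,x)\cap\bar B(a,2d(a,E_i(t,x)))$ and $E_i(t,x)=\mathrm{epi}\,H_i^*(t,x,\cdot)$. If $H_i\to H_0$ uniformly on compact subsets of $[0,T]\times\mathbb{R}^n\times\mathbb{R}^n$, then for every $(t_0,x_0,a_0)\in[0,T]\times\mathbb{R}^n\times\mathbb{R}^{n+1}$ and every sequence $(t_i,x_i,a_i)\to(t_0,x_0,a_0)$ we have $\mathsf{e}_i(t_i,x_i,a_i)\to\mathsf{e}_0(t_0,x_0,a_0)$.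
   Context: $H_i^*(t,x,v)=\sup_p\{\langle v,p\rangle-H_i(t,x,p)\}$; $\mathrm{epi}\,\varphi=\{(v,\eta)\in\mathbb{R}^n\times\mathbb{R}:\varphi(v)\le\eta\}$; $d(a,K)=\inf_{\xi\in K}|a-\xi|$; $\bar B(a,r)$ closed ball. Steiner point of a nonempty compact convex $K\subset\mathbb{R}^m$: $s_m(K)=m\int_{S^{m-1}}p\,\max_{y\in K}\langle p,y\rangle\,\mu(dp)$, where $\mu$ is the rotation-invariant probability measure on the unit sphere $S^{m-1}$. *)

(* Defs.v *)
From HB Require Import structures.
From mathcomp Require Import all_boot all_order all_algebra.
From mathcomp Require Import all_classical all_reals all_analysis.
Set Implicit Arguments. Unset Strict Implicit. Unset Printing Implicit Defensive.
Import Order.TTheory GRing.Theory Num.Theory.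
Import numFieldNormedType.Exports.
Local Open Scope classical_set_scope.
Local Open Scope ring_scope.

Section Defs.
Variable R : realType.

Definition dotv m (u v : 'rV[R]_m) : R := \sum_(j < m) u 0 j * v 0 j.
Definition enorm m (v : 'rV[R]_m) : R := Num.sqrt (dotv v v).

Definition Hstar n (H : R -> 'rV[R]_n -> 'rV[R]_n -> R) t x (v : 'rV[R]_n)
  : \bar R := ereal_sup [set (dotv v p - H t x p)%:E | p in [set: 'rV[R]_n]].

Definition vpart n (a : 'rV[R]_n.+1) : 'rV[R]_n := \row_(j < n) a 0 (widen_ord (leqnSn n) j).
Definition etapart n (a : 'rV[R]_n.+1) : R := a 0 ord_max.

Definition Eset n (H : R -> 'rV[R]_n -> 'rV[R]_n -> R) t x : set 'rV[R]_n.+1 :=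
  [set a | (Hstar H t x (vpart a) <= (etapart a)%:E)%E].

Definition dist m (a : 'rV[R]_m) (K : set 'rV[R]_m) : R :=
  inf [set enorm (a - xi) | xi in K].

Definition cball m (a : 'rV[R]_m) (r : R) : set 'rV[R]_m := [set y | enorm (y - a) <= r].

Definition Phi n (H : R -> 'rV[R]_n -> 'rV[R]_n -> R) t x (a : 'rV[R]_n.+1) :=
  Eset H t x `&` cball a (2 * dist a (Eset H t x)).

Definition supp_fun m (K : set 'rV[R]_m) (p : 'rV[R]_m) : R :=
  sup [set dotv p y | y in K].

(* Lebesgue integral over the cube [-1,1]^m, as iterated one-dimensional
   Lebesgue integrals (Fubini) *)
Definition upd m (x : 'rV[R]_m) (k : nat) (y : R) : 'rV[R]_m :=
  \row_j (if nat_of_ord j == k then y else x 0 j).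
Fixpoint iterint m (k : nat) (F : 'rV[R]_m -> R) (x : 'rV[R]_m) : R :=
  match k with
  | 0 => F x
  | k'.+1 => Rintegral lebesgue_measure `[-1%R, 1%R]
              (fun y => iterint k' F (upd x k' y))
  end.
Definition cube_int m (F : 'rV[R]_m -> R) : R := iterint m F 0.

(* integral of g against the rotation-invariant probability measure mu on the
   unit sphere S^{m-1}, realised as the (normalised) cone measure:
   int_S g dmu = (1/|B|) int_{B \ {0}} g(x/|x|) dx, B the closed unit ball *)
Definition sphere_avg m (g : 'rV[R]_m -> R) : R :=
  cube_int (fun x : 'rV[R]_m =>
              if (0 < enorm x) && (enorm x <= 1) then g ((enorm x)^-1 *: x) else 0)
  / cube_int (fun x : 'rV[R]_m => if enorm x <= 1 then 1 else 0).

Definition steiner m (K : set 'rV[R]_m) : 'rV[R]_m :=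
  \row_(j < m) (m%:R * sphere_avg (fun p => p 0 j * supp_fun K p)).

Definition esel n (H : R -> 'rV[R]_n -> 'rV[R]_n -> R) t x (a : 'rV[R]_n.+1) :=
  steiner (Phi H t x a).

End Defs.

(* Main.v *)
(** Write [E_i] for the epigraph [E(t_i, x_i)] of the conjugate of
    [h_i = H_i(t_i, x_i, .)]; the hypotheses make [h_i] converge to [h_0] uniformly on
    bounded sets. First, [E_i] converges to [E_0] in the sense of Painleve and
    Kuratowski. The upper half is clear, [E_i] being an intersection of half-spaces
    depending continuously on [h_i]. For the lower half, a point [(v, s)] of [E_0] is an
    affine minorant [<v, .> - s] of [h_0], hence an almost minorant of [h_i] on a large
    ball; minimising [h_i - <v, .> + lam / 2 |.|^2] there yields a genuine affine
    minorant of [h_i] with nearby slope. Convergence passes to the distances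
    [d(a_i, E_i)], to the truncations [Phi_i] (by convexity of [E_0], points strictly
    inside the limit ball are dense in [Phi_0]), and to support functions.
    Finally, the radial integrand of the Steiner point is discontinuous only at 0 and on
    the unit sphere, which each line parallel to an axis meets in finitely many points,
    so dominated convergence applies to the innermost integral, whose value is
    continuous, and then to each outer one. *)

Require Import Defs.
From HB Require Import structures.
From mathcomp Require Import all_boot all_order all_algebra.
From mathcomp Require Import all_classical all_reals all_analysis.
From mathcomp Require Import ring lra.
Import Order.TTheory GRing.Theory Num.Theory.
Import numFieldNormedType.Exports.
Local Open Scope classical_set_scope.
Local Open Scope ring_scope.
Set Implicit Arguments.
Unset Strict Implicit.
Unset Printing Implicit Defensive.

(** * Euclidean norm *)

Section Euclid.
Variable R : realType.
Implicit Type m : nat.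

Lemma dotvC m (u v : 'rV[R]_m) : dotv u v = dotv v u.
Proof. by apply: eq_bigr => j _; rewrite mulrC. Qed.

Lemma dotvDl m (u v w : 'rV[R]_m) : dotv (u + v) w = dotv u w + dotv v w.
Proof. by rewrite -big_split; apply: eq_bigr => j _; rewrite mxE mulrDl. Qed.

Lemma dotvZl m c (u w : 'rV[R]_m) : dotv (c *: u) w = c * dotv u w.
Proof. by rewrite mulr_sumr; apply: eq_bigr => j _; rewrite mxE mulrA. Qed.

Lemma dotvNl m (u w : 'rV[R]_m) : dotv (- u) w = - dotv u w.
Proof. by rewrite -scaleN1r dotvZl mulN1r. Qed.

Lemma dotvDr m (u v w : 'rV[R]_m) : dotv w (u + v) = dotv w u + dotv w v.
Proof. by rewrite dotvC dotvDl ![dotv _ w]dotvC. Qed.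

Lemma dotvZr m c (u w : 'rV[R]_m) : dotv w (c *: u) = c * dotv w u.
Proof. by rewrite dotvC dotvZl dotvC. Qed.

Lemma dotvNr m (u w : 'rV[R]_m) : dotv w (- u) = - dotv w u.
Proof. by rewrite dotvC dotvNl dotvC. Qed.

Lemma dotv0 m (u : 'rV[R]_m) : dotv u 0 = 0.
Proof. by rewrite -(scale0r 0) dotvZr mul0r. Qed.

Definition dotvE := (dotvDl, dotvDr, dotvNl, dotvNr, dotvZl, dotvZr).

Lemma dotv_ge0 m (u : 'rV[R]_m) : 0 <= dotv u u.
Proof. by apply: sumr_ge0 => j _; rewrite -expr2 sqr_ge0. Qed.

Lemma dotv_eq0 m (u : 'rV[R]_m) : dotv u u = 0 -> u = 0.
Proof.
move/eqP; rewrite psumr_eq0; last by move=> j _; rewrite -expr2 sqr_ge0.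
move=> /allP u0; apply/rowP => j; rewrite mxE.
by have := u0 j (mem_index_enum _); rewrite /= mulf_eq0 orbb => /eqP.
Qed.

Lemma enorm_ge0 m (u : 'rV[R]_m) : 0 <= enorm u.
Proof. exact: sqrtr_ge0. Qed.

Lemma sqr_enorm m (u : 'rV[R]_m) : enorm u ^+ 2 = dotv u u.
Proof. by rewrite sqr_sqrtr // dotv_ge0. Qed.

Lemma enorm0 m : enorm (0 : 'rV[R]_m) = 0.
Proof. by rewrite /enorm dotv0 sqrtr0. Qed.

Lemma enorm_eq0 m (u : 'rV[R]_m) : enorm u = 0 -> u = 0.
Proof. by move=> u0; apply: dotv_eq0; rewrite -sqr_enorm u0 expr0n. Qed.

Lemma enormN m (u : 'rV[R]_m) : enorm (- u) = enorm u.
Proof. by rewrite /enorm dotvNl dotvNr opprK. Qed.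

Lemma enormZ m c (u : 'rV[R]_m) : enorm (c *: u) = `|c| * enorm u.
Proof.
by rewrite /enorm dotvZl dotvZr mulrA -expr2 sqrtrM ?sqr_ge0// sqrtr_sqr.
Qed.

(** Cauchy-Schwarz, by expanding the square of [enorm v *: u - enorm u *: v] and cancelling the
    factor [enorm u * enorm v]. *)
Lemma dotv_le_enorm m (u v : 'rV[R]_m) : dotv u v <= enorm u * enorm v.
Proof.
have [u0|u0] := eqVneq (enorm u) 0.
  by rewrite (enorm_eq0 u0) dotvC dotv0 enorm0 mul0r.
have [v0|v0] := eqVneq (enorm v) 0.
  by rewrite (enorm_eq0 v0) dotv0 enorm0 mulr0.
have up : 0 < enorm u by rewrite lt0r u0 enorm_ge0.
have vp : 0 < enorm v by rewrite lt0r v0 enorm_ge0.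
have := dotv_ge0 (enorm v *: u - enorm u *: v).
rewrite !dotvE -!sqr_enorm (dotvC v u) => h.
have uv : 0 < enorm u * enorm v by rewrite mulr_gt0.
have : 0 <= (enorm u * enorm v) * (enorm u * enorm v - dotv u v) by lra.
by rewrite pmulr_rge0// subr_ge0.
Qed.

Lemma enorm_triangle m (u v : 'rV[R]_m) : enorm (u + v) <= enorm u + enorm v.
Proof.
rewrite -(@ler_pXn2r _ 2)// ?nnegrE ?addr_ge0 ?enorm_ge0//.
rewrite sqr_enorm !dotvE (dotvC v u) sqrrD !sqr_enorm.
have := dotv_le_enorm u v; lra.
Qed.

Lemma coord_le_norm m (u : 'rV[R]_m) j : `|u 0 j| <= `|u|.
Proof.
by rewrite [leRHS]mx_normrE; apply/bigmax_geP; right; exists (0, j).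
Qed.

(** The topology on row vectors is that of the max norm; through this comparison Euclidean estimates
    yield neighbourhoods. *)
Lemma norm_le_enorm m (u : 'rV[R]_m) : `|u| <= enorm u.
Proof.
rewrite [leLHS]mx_normrE; apply/bigmax_leP; split; first exact: enorm_ge0.
move=> [i j] _ /=; rewrite ord1 -sqrtr_sqr ler_wsqrtr// /dotv (bigD1 j)//=.
by rewrite expr2 lerDl; apply: sumr_ge0 => k _; rewrite -expr2 sqr_ge0.
Qed.

Lemma dotv_le_norm m (u v : 'rV[R]_m) : `|dotv u v| <= m%:R * (`|u| * `|v|).
Proof.
apply: le_trans (ler_norm_sum _ _ _) _.
apply: (@le_trans _ _ (\sum_(j < m) `|u| * `|v|)).
  by apply: ler_sum => j _; rewrite normrM ler_pM// coord_le_norm.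
by rewrite sumr_const card_ord mulr_natl.
Qed.

Lemma cvg_rV (T : Type) (F : set_system T) {FF : Filter F} m
    (f : T -> 'rV[R]_m) (l : 'rV[R]_m) :
  (forall j, f z 0 j @[z --> F] --> l 0 j) -> f @ F --> l.
Proof.
move=> fl; apply/cvg_ballP => e e0.
have H j : \forall z \near F, ball (l 0 j) e (f z 0 j).
  by move: (fl j) => /cvg_ballP/(_ _ e0).
have : \forall z \near F, forall j, ball (l 0 j) e (f z 0 j).
  exact: filter_forall.
apply: filterS => z fz; split => // i j; rewrite ord1; exact: fz.
Qed.

Lemma cvg_coord (T : Type) (F : set_system T) {FF : Filter F} m
    (f : T -> 'rV[R]_m) (l : 'rV[R]_m) j :
  f @ F --> l -> f z 0 j @[z --> F] --> l 0 j.
Proof. by move=> fl; exact: (cvg_comp _ _ fl (@coord_continuous _ _ _ 0 j l)). Qed.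

Lemma cvg_dotv (T : Type) (F : set_system T) {FF : Filter F} m
    (f g : T -> 'rV[R]_m) (u v : 'rV[R]_m) :
  f @ F --> u -> g @ F --> v -> dotv (f z) (g z) @[z --> F] --> dotv u v.
Proof.
move=> fu gv; apply: cvg_big => [|j _]; first exact: add_continuous.
by apply: cvgM; exact: cvg_coord.
Qed.

Lemma cvg_enorm (T : Type) (F : set_system T) {FF : Filter F} m
    (f : T -> 'rV[R]_m) (u : 'rV[R]_m) :
  f @ F --> u -> enorm (f z) @[z --> F] --> enorm u.
Proof.
by move=> fu; exact: (cvg_comp _ _ (cvg_dotv fu fu) (@sqrt_continuous _ _)).
Qed.

End Euclid.

(** * Set convergence and distances *)

Section SetConvergence.
Variables (R : realType) (m : nat).
Local Notation V := 'rV[R]_m.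
Implicit Types (K : set V) (Ks : nat -> set V) (a y p : V).

(* Painleve-Kuratowski convergence *)
Definition set_cvg Ks K :=
  (forall y, K y -> forall U, nbhs y U -> \forall i \near \oo, (Ks i `&` U) !=set0)
  /\ (forall y, ~ K y -> \forall z \near filter_prod (nbhs y) \oo, ~ Ks z.2 z.1).

Definition convex_set K := forall y z (l : R),
  K y -> K z -> 0 <= l <= 1 -> K (l *: y + (1 - l) *: z).

(** Compactness in covering form makes an estimate that holds near each point, for large [i],
    uniform on [C]. Often [P i y] is an implication from [Ks i y], vacuous near points outside the
    limit set. *)
Lemma near_in_compact (C : set V) (P : nat -> V -> Prop) : compact C ->
  (forall y, C y -> \forall z \near filter_prod (nbhs y) \oo, P z.2 z.1) ->
  \forall i \near \oo, forall y, C y -> P i y.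
Proof.
move=> /compact_near_coveringP cC CP.
exact: (cC nat \oo P _ CP).
Qed.

(** Through constant sequences, later convergence results become continuity statements about a
    single set. *)
Lemma set_cvg_cst K : closed K -> set_cvg (fun=> K) K.
Proof.
move=> cK; split=> [y Ky U yU|y Ky].
  by apply: nearW => i; exists y; split => //; exact: nbhs_singleton.
have yK : \forall y' \near y, ~ K y'.
  by apply: open_nbhs_nbhs; split => //; exact: closed_openC.
exact: (cvg_fst yK).
Qed.

Lemma dist_has_inf a K : K !=set0 -> has_inf [set enorm (a - xi) | xi in K].
Proof.
move=> [y Ky]; split; first by exists (enorm (a - y)); exists y.
by exists 0 => _ [z _ <-]; exact: enorm_ge0.
Qed.

Lemma dist_le a K y : K y -> dist a K <= enorm (a - y).
Proof.
move=> Ky; apply: ge_inf; last by exists y.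
by exists 0 => _ [z _ <-]; exact: enorm_ge0.
Qed.

Lemma dist_ge a K r : K !=set0 -> (forall y, K y -> r <= enorm (a - y)) -> r <= dist a K.
Proof.
move=> [y Ky] rK; apply: lb_le_inf; first by exists (enorm (a - y)); exists y.
by move=> _ [z Kz <-]; exact: rK.
Qed.

Lemma dist_ge0 a K : K !=set0 -> 0 <= dist a K.
Proof. by move=> K0; apply: dist_ge => // y _; exact: enorm_ge0. Qed.

Lemma dist_lt a K r : K !=set0 -> dist a K < r -> exists2 y, K y & enorm (a - y) < r.
Proof.
move=> /(dist_has_inf a) hK; rewrite -subr_gt0 => r0.
have [_ [y Ky <-]] := inf_adherent r0 hK.
by rewrite -/(dist a K) subrKC => yr; exists y.
Qed.

Lemma dist_eq0 a K : closed K -> K !=set0 -> dist a K = 0 -> K a.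
Proof.
move=> cK K0 d0; apply: contrapT => Ka.
have : nbhs a (~` K) by apply: open_nbhs_nbhs; split => //; exact: closed_openC.
move=> /nbhs_normP [e /= e0 eK].
have : e <= dist a K.
  apply: dist_ge => // y Ky; rewrite leNgt; apply/negP => aye.
  by apply: (eK y) => //=; apply: le_lt_trans aye; exact: norm_le_enorm.
by rewrite d0 leNgt e0.
Qed.

Lemma cvg_enormB (T : Type) (F : set_system T) {FF : Filter F} (f g : T -> V) y a :
  f @ F --> y -> g @ F --> a -> enorm (f z - g z) @[z --> F] --> enorm (y - a).
Proof. by move=> fy ga; apply: cvg_enorm; exact: cvgB. Qed.

Lemma cvg_normB (T : Type) (F : set_system T) {FF : Filter F} (f g : T -> V) y a :
  f @ F --> y -> g @ F --> a -> `|f z - g z| @[z --> F] --> `|y - a|.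
Proof. by move=> fy ga; apply: cvg_norm; exact: cvgB. Qed.

Lemma cvg_enormB_prod (a_ : nat -> V) y a : a_ @ \oo --> a ->
  enorm (z.1 - a_ z.2) @[z --> filter_prod (nbhs y) \oo] --> enorm (y - a).
Proof.
move=> aa; apply: cvg_enormB; first exact: cvg_fst.
exact: (cvg_comp _ _ cvg_snd aa).
Qed.

Lemma enormBC (u v : V) : enorm (u - v) = enorm (v - u).
Proof. by rewrite -enormN opprB. Qed.

Lemma compact_ball (a : V) r : compact [set y : V | `|y - a| <= r].
Proof.
apply: bounded_closed_compact.
  exists (r + `|a|); split; first exact: num_real.
  move=> M rM y /= yr; apply: le_trans (ltW rM).
  by rewrite -(subrK a y); apply: le_trans (ler_normD _ _) _; rewrite lerD2r.
rewrite (_ : mkset _ = (fun y => `|y - a|) @^-1` [set x | x <= r]) //.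
apply: closed_comp; last exact: closed_le.
move=> y _; have := cvg_normB (@cvg_id _ (nbhs y)) (@cvg_cst _ a _ (nbhs y) _).
exact.
Qed.

Lemma closed_cball a' r : closed (cball a' r : set V).
Proof.
rewrite /cball (_ : mkset _ = (fun y => enorm (y - a')) @^-1` [set x | x <= r]) //.
apply: closed_comp; last exact: closed_le.
move=> y _; have := cvg_enormB (@cvg_id _ (nbhs y)) (@cvg_cst _ a' _ (nbhs y) _).
exact.
Qed.

Lemma compact_cball (a : V) r : compact (cball a r : set V).
Proof.
apply: (@subclosed_compact _ _ [set y : V | `|y - a| <= r]).
- exact: closed_cball.
- exact: compact_ball.
- by move=> y; apply: le_trans; exact: norm_le_enorm.
Qed.

(** * Distances and truncations under set convergence *)

Section Distance.
Variables (Ks : nat -> set V) (K : set V) (a_ : nat -> V) (a : V).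
Hypotheses (Ks_nonempty : forall i, Ks i !=set0) (K_nonempty : K !=set0).
Hypotheses (KsK : set_cvg Ks K) (a_a : a_ @ \oo --> a).

(** From above, a nearly closest point of [K] is approached by points of [Ks i]; from below,
    compactness excludes points of [Ks i] too close to [a_ i]. *)
Lemma cvg_dist : dist (a_ i) (Ks i) @[i --> \oo] --> dist a K.
Proof.
apply/cvgrPdist_le => e e0.
have up : \forall i \near \oo, dist (a_ i) (Ks i) <= dist a K + e.
  have e20 : 0 < e / 2 by rewrite divr_gt0.
  have [|c Kc ac] := @dist_lt a K (dist a K + e / 2) K_nonempty.
    by rewrite ltrDl.
  have := @cvg_enormB_prod a_ c a a_a => /cvgr_lt/(_ (dist a K + e)).
  have /[swap]/[apply] : enorm (c - a) < dist a K + e.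
    by rewrite enormBC; apply: lt_trans ac _; lra.
  move=> [[A B] /= [cA oB] AB].
  have := KsK.1 _ Kc _ cA; apply: filterS2 oB => i Bi [y [Ky Ay]].
  apply: le_trans (dist_le _ Ky) _; rewrite enormBC ltW //.
  exact: (AB (y, i)).
have lo : \forall i \near \oo, dist a K - e <= dist (a_ i) (Ks i).
  (* Covering handles the points in this fixed ball. A point outside it is farther than [dist a K]
     from [a_ i] once [a_ i] is within 1 of [a]. *)
  have : \forall i \near \oo, forall y, `|y - a| <= dist a K + 1 ->
     Ks i y -> dist a K - e < enorm (y - a_ i).
    apply: (@near_in_compact _ (fun i y => Ks i y -> _)); first exact: compact_ball.
    move=> y _; have [Ky|Ky] := pselect (K y); last first.
      by apply: filterS (KsK.2 _ Ky).
    have := @cvg_enormB_prod a_ y a a_a => /cvgr_gt/(_ (dist a K - e)).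
    have /[swap]/[apply] : dist a K - e < enorm (y - a).
      by have := dist_le a Ky; rewrite enormBC; lra.
    by apply: filterS.
  have : \forall i \near \oo, `|a - a_ i| < 1 by exact: cvgr_dist_lt.
  apply: filterS2 => i ai Hi; apply: dist_ge => // y Ky; rewrite enormBC.
  have [ya|ya] := leP (`|y - a|) (dist a K + 1); first by rewrite ltW // Hi.
  apply: le_trans (norm_le_enorm _).
  have := ler_distD (a_ i) y a; rewrite (distrC (a_ i) a).
  by move: e0 ai ya; lra.
by apply: filterS2 up lo => i; rewrite ler_distlC; lra.
Qed.

(** The truncation of [Phi], for an arbitrary set in place of the epigraph. *)
Definition near_part K' a' := K' `&` cball a' (2 * dist a' K').

(** If the distance is positive, some point is strictly closer than twice the distance; if it is
    zero, closedness puts [a'] itself in the set. *)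
Lemma near_part_nonempty K' a' : closed K' -> K' !=set0 -> near_part K' a' !=set0.
Proof.
move=> cK K0; have [d0|d0] := eqVneq (dist a' K') 0.
  exists a'; split; first exact: dist_eq0.
  by rewrite /cball /= subrr enorm0 d0 mulr0.
have dp : 0 < dist a' K' by rewrite lt0r d0 dist_ge0.
have [|y Ky ya] := @dist_lt a' K' (2 * dist a' K') K0; first lra.
by exists y; split => //; rewrite /cball /= enormBC ltW.
Qed.

Hypotheses (Ks_closed : forall i, closed (Ks i)).
Hypotheses (K_convex : convex_set K).

Lemma set_cvg_near_part : set_cvg (fun i => near_part (Ks i) (a_ i)) (near_part K a).
Proof.
have d2 : 2 * dist (a_ i) (Ks i) @[i --> \oo] --> 2 * dist a K.
  by apply: cvgM; [exact: cvg_cst|exact: cvg_dist].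
split=> [y [Ky ya] U yU|y].
  (* At distance zero the limit ball has no interior: it is the point [a], and every point of the
     truncations, whose radii tend to 0, approaches it. *)
  have [d0|d0] := eqVneq (dist a K) 0.
    have yaE : y = a.
      apply/eqP; rewrite -subr_eq0; apply/eqP/enorm_eq0/eqP.
      by rewrite eq_le enorm_ge0 andbT; move: ya; rewrite /cball /= d0 mulr0.
    subst y; move: yU => /nbhs_normP [e /= e0 eU].
    have e20 : 0 < e / 2 by rewrite divr_gt0.
    have h1 : \forall i \near \oo, `|a - a_ i| < e / 2 by exact: cvgr_dist_lt.
    have h2 : \forall i \near \oo, 2 * dist (a_ i) (Ks i) < e / 2.
      by apply: (cvgr_lt _ d2); rewrite d0 mulr0.
    apply: filterS2 h1 h2 => i h1 h2.
    have [z [Kz az]] := near_part_nonempty (a_ i) (@Ks_closed i) (Ks_nonempty i).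
    exists z; split => //; apply: eU => /=.
    have := ler_distD (a_ i) a z; rewrite (distrC (a_ i) z).
    have := norm_le_enorm (z - a_ i).
    by move: az; rewrite /cball /=; lra.
  have dp : 0 < dist a K by rewrite lt0r d0 dist_ge0.
  have [|z Kz za] := @dist_lt a K (2 * dist a K) K_nonempty; first lra.
  (* Since [y] may lie on the boundary of the limit ball, it is moved slightly towards [z], which is
     strictly inside. The resulting [w] is in [K] by convexity and strictly inside, so points of
     [Ks i] near [w] satisfy the constraint of index [i]. *)
  have yzU : \forall l \near 0^'+, nbhs (l *: z + (1 - l) *: y) U.
    have : l *: z + (1 - l) *: y @[l --> (0 : R)^'+] --> 0 *: z + (1 - 0) *: y.
      apply: cvg_at_right_filter; apply: cvgD.
        by apply: cvgZ; [exact: cvg_id|exact: cvg_cst].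
      apply: cvgZ; [|exact: cvg_cst].
      by apply: cvgB; [exact: cvg_cst|exact: cvg_id].
    by rewrite scale0r subr0 scale1r add0r => /(_ _ (nbhs_interior yU)).
  have [l [l0 l1 Ul]] : exists l : R, [/\ 0 < l, l < 1 & nbhs (l *: z + (1 - l) *: y) U].
    apply: (@filter_ex _ (0 : R)^'+); near=> l; split; near: l.
    - exact: nbhs_right_gt.
    - exact: nbhs_right_lt.
    - exact: yzU.
  pose w : V := l *: z + (1 - l) *: y.
  have Kw : K w by apply: K_convex => //; lra.
  have wa : enorm (w - a) < 2 * dist a K.
    rewrite (_ : w - a = l *: (z - a) + (1 - l) *: (y - a)); last first.
      by rewrite /w; apply/rowP => j; rewrite !mxE; ring.
    apply: le_lt_trans (enorm_triangle _ _) _.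
    rewrite !enormZ (gtr0_norm l0) ger0_norm; last lra.
    rewrite (enormBC z) (_ : 2 * _ = l * (2 * dist a K) + (1 - l) * (2 * dist a K)).
      by apply: ltr_leD; [rewrite ltr_pM2l|rewrite ler_wpM2l//; lra].
    ring.
  have : (2 * dist (a_ z.2) (Ks z.2) - enorm (z.1 - a_ z.2)) @[z --> filter_prod (nbhs w) \oo]
       --> 2 * dist a K - enorm (w - a).
    apply: cvgB; last exact: cvg_enormB_prod.
    exact: (cvg_comp _ _ cvg_snd d2).
  move=> /cvgr_gt/(_ 0); rewrite subr_gt0 => /(_ wa) [[A B] /= [cA oB] AB].
  have oU : \forall i \near \oo, (Ks i `&` (A `&` U)) !=set0.
    by apply: (KsK.1 _ Kw); exact: filterI.
  apply: filterS2 oB oU => i Bi [v [Kv [Av Uv]]].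
  exists v; split => //; split => //.
  by have := AB (v, i) (conj Av Bi); rewrite /= subr_gt0 => /ltW.
move=> nKa; have [Ky|Ky] := pselect (K y); last first.
  by apply: filterS (KsK.2 _ Ky) => z nK [].
have ya : 2 * dist a K < enorm (y - a).
  by rewrite ltNge; apply/negP => ya; exact: nKa.
have : (enorm (z.1 - a_ z.2) - 2 * dist (a_ z.2) (Ks z.2)) @[z --> filter_prod (nbhs y) \oo]
       --> enorm (y - a) - 2 * dist a K.
  apply: cvgB; first exact: cvg_enormB_prod.
  exact: (cvg_comp _ _ cvg_snd d2).
move=> /cvgr_gt/(_ 0); rewrite subr_gt0 => /(_ ya).
by apply: filterS => z; rewrite subr_gt0 => zz [_]; rewrite /cball /= leNgt zz.
Unshelve. all: end_near. Qed.

End Distance.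

End SetConvergence.

(** * Support functions under set convergence *)

Section SupportFunction.
Variables (R : realType) (m : nat).
Local Notation V := 'rV[R]_m.
Implicit Types (K : set V) (Ks : nat -> set V) (p : V) (B : R).

Lemma ubound_dotv K p B : (forall y, K y -> `|y| <= B) ->
  ubound [set dotv p y | y in K] (m%:R * (`|p| * B)).
Proof.
move=> KB _ [y Ky <-]; apply: le_trans (ler_norm _) _.
apply: le_trans (dotv_le_norm _ _) _.
by rewrite ler_wpM2l// ler_wpM2l// KB.
Qed.

Lemma dotv_le_supp K p B y : (forall y, K y -> `|y| <= B) -> K y ->
  dotv p y <= supp_fun K p.
Proof.
move=> KB Ky; apply: ub_le_sup; last by exists y.
by exists (m%:R * (`|p| * B)); exact: ubound_dotv.
Qed.

Lemma norm_supp_fun K p B : 0 <= B -> (forall y, K y -> `|y| <= B) ->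
  `|supp_fun K p| <= m%:R * (`|p| * B).
Proof.
move=> B0 KB; have [->|/set0P [y Ky]] := eqVneq K set0.
  by rewrite /supp_fun image_set0 sup0 normr0 !mulr_ge0.
rewrite ler_norml; apply/andP; split; last first.
  by apply: ge_sup; [exists (dotv p y); exists y|exact: ubound_dotv].
apply: le_trans (dotv_le_supp p KB Ky); rewrite lerNl.
apply: le_trans (ler_norm _) _; rewrite normrN.
apply: le_trans (dotv_le_norm _ _) _.
by rewrite ler_wpM2l// ler_wpM2l// KB.
Qed.

(** From below, a nearly maximising point of [K] is approached by points of [Ks i]; from above,
    covering the common ball of radius [B] gives one bound for all points of [Ks i]. *)
Lemma cvg_supp_fun Ks K (p_ : nat -> V) p B :
  set_cvg Ks K -> K !=set0 ->
  (forall i y, Ks i y -> `|y| <= B) -> (forall y, K y -> `|y| <= B) ->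
  p_ @ \oo --> p -> supp_fun (Ks i) (p_ i) @[i --> \oo] --> supp_fun K p.
Proof.
move=> KsK K0 KsB KB pp; apply/cvgrPdist_le => e e0.
have dotz y : dotv (p_ z.2) z.1 @[z --> filter_prod (nbhs y) \oo] --> dotv p y.
  by apply: cvg_dotv; [exact: (cvg_comp _ _ cvg_snd pp)|exact: cvg_fst].
have lo : \forall i \near \oo, supp_fun K p - e <= supp_fun (Ks i) (p_ i).
  have hK : has_sup [set dotv p y | y in K].
    split; first by move: K0 => [y Ky]; exists (dotv p y); exists y.
    by exists (m%:R * (`|p| * B)); exact: ubound_dotv.
  have [_ [y Ky <-] ye] := sup_adherent e0 hK.
  have := cvgr_gt _ (dotz y) _ ye => -[[A D] /= [cA oD] AD].
  have oA : \forall i \near \oo, (Ks i `&` A) !=set0 by exact: (KsK.1 _ Ky).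
  apply: filterS2 oD oA => i Di [z [Kz Az]].
  apply: le_trans (dotv_le_supp _ (KsB i) Kz).
  by have := AD (z, i) (conj Az Di); rewrite /= -/(supp_fun K p) => /ltW.
have up : \forall i \near \oo, forall y, `|y - 0| <= B -> Ks i y ->
    dotv (p_ i) y < supp_fun K p + e.
  apply: (@near_in_compact _ _ _ (fun i y => Ks i y -> _)); first exact: compact_ball.
  move=> y _; have [Ky|Ky] := pselect (K y); last by apply: filterS (KsK.2 _ Ky).
  have : dotv p y < supp_fun K p + e by have := dotv_le_supp p KB Ky; lra.
  by move=> /(cvgr_lt _ (dotz y) _); apply: filterS.
(* Eventual nonemptiness rules out the default value 0 of [sup], to which the estimate [up] would
   say nothing. *)
have ne : \forall i \near \oo, (Ks i `&` setT) !=set0.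
  by move: K0 => [y Ky]; apply: (KsK.1 _ Ky); exact: filterT.
near=> i; rewrite ler_distlC.
have -> /= : supp_fun K p - e <= supp_fun (Ks i) (p_ i) by near: i.
have [y [Ky _]] : (Ks i `&` setT) !=set0 by near: i.
apply: ge_sup; first by exists (dotv (p_ i) y); exists y.
move=> _ [z Kz <-]; apply/ltW.
have : Ks i z by []; have : `|z - 0| <= B by rewrite subr0 (KsB i).
by move: z {Kz}; near: i.
Unshelve. all: end_near. Qed.

End SupportFunction.

(** * Epigraphs of conjugates *)

Section ConjugateEpigraph.
Variables (R : realType) (n : nat).
Local Notation V := 'rV[R]_n.
Implicit Types (h : V -> R) (v p : V).

Definition convex_fun h := forall p q (l : R), 0 <= l <= 1 ->
  h (l *: p + (1 - l) *: q) <= l * h p + (1 - l) * h q.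

Lemma continuous_dotv v : continuous (dotv v).
Proof.
move=> p; have := cvg_dotv (@cvg_cst _ v _ (nbhs p) _) (@cvg_id _ (nbhs p)).
exact.
Qed.

Lemma continuous_sqr : continuous (fun p : V => dotv p p).
Proof.
move=> p; have := cvg_dotv (@cvg_id _ (nbhs p)) (@cvg_id _ (nbhs p)).
exact.
Qed.

(* [v' - v] is [- lam] times a minimiser of [h - <v, .> + lam / 2 |.|^2] over
   the ball; the last assumption makes that minimiser an interior point *)
Lemma minorant_near h v (b r lam : R) : convex_fun h -> continuous h ->
  0 < r -> 0 < lam -> (forall p, enorm p <= r -> dotv v p - h p <= b) ->
  h 0 + b < lam * r ^+ 2 / 2 ->
  exists v', dotv (v' - v) (v' - v) <= 2 * lam * (h 0 + b) /\
             forall p, dotv v' p - h p <= b.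
Proof.
move=> hconv hcont r0 lam0 hb hr.
pose phi p := h p - dotv v p + lam / 2 * dotv p p.
have cphi : continuous phi.
  move=> p; have := cvgD (cvgB (hcont p) (@continuous_dotv v p))
    (cvgM (@cvg_cst _ (lam / 2) _ (nbhs p) _) (@continuous_sqr p)).
  exact.
have K0 : (cball 0 r : set V) !=set0.
  by exists 0; rewrite /cball /= subrr enorm0 ltW.
have [c /set_mem rc cmin] := EVT_min_rV K0 (@compact_cball _ _ 0 r) (continuous_subspaceT cphi).
have {}rc : enorm c <= r by move: rc; rewrite /cball /= subr0.
have {}cmin p : enorm p <= r -> phi c <= phi p.
  by move=> pr; apply: cmin; rewrite inE /cball /= subr0.
have phi0 : phi 0 = h 0 by rewrite /phi !dotv0 mulr0 subr0 addr0.
have hc := hb _ rc.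
(* From [phi c <= phi 0] and the bound [b] at [c]; the assumption on [r] then makes [c] interior. *)
have cc : lam / 2 * dotv c c <= h 0 + b.
  by have := cmin 0; rewrite enorm0 phi0 => /(_ (ltW r0)); rewrite /phi; lra.
have cr : enorm c < r.
  rewrite -(@ltr_pXn2r _ 2)// ?nnegrE ?enorm_ge0 ?(ltW r0)//.
  rewrite sqr_enorm -(@ltr_pM2l _ (lam / 2)); last by rewrite divr_gt0.
  by apply: le_lt_trans cc _; lra.
exists (v - lam *: c); split.
  rewrite addrAC subrr add0r !dotvE.
  rewrite (_ : - _ = 2 * lam * (lam / 2 * dotv c c)); last by field.
  by rewrite ler_wpM2l// mulr_ge0// ltW.
move=> p; pose d := p - c.
(* The first-order optimality condition at [c]: [h] lies above the affine function through
   [(c, h c)] of slope [v - lam *: c]. The bound [b] at [c] and [0 <= dotv c c] finish. *)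
suff : 0 <= h p - h c - dotv v d + lam * dotv c d.
  by rewrite /d !dotvE; have := dotv_ge0 c; nra.
set X := (X in 0 <= X); rewrite leNgt; apply/negP => X0.
pose Y := lam / 2 * dotv d d.
have Y0 : 0 <= Y by rewrite mulr_ge0 ?dotv_ge0// divr_ge0// ltW.
have near_c : \forall l \near (0 : R)^'+, enorm (c + l *: d) < r.
  have : c + l *: d @[l --> (0 : R)^'+] --> c + 0 *: d.
    apply: cvg_at_right_filter; apply: cvgD; first exact: cvg_cst.
    by apply: cvgZ; [exact: cvg_id|exact: cvg_cst].
  by rewrite scale0r addr0 => /cvg_enorm/cvgr_lt; exact.
(* Minimality of [c] and convexity will give [0 <= l * (X + l * Y)], which fails for so small an [l]
   if [X] is negative. The added 1 keeps the denominator positive. *)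
have [l [l0 l1 lX /ltW/cmin]] : exists l : R,
    [/\ 0 < l, l < 1, l < - X / (Y + 1) & enorm (c + l *: d) < r].
  apply: (@filter_ex _ (0 : R)^'+); near=> l; split; near: l.
  - exact: nbhs_right_gt.
  - exact: nbhs_right_lt.
  - by apply: nbhs_right_lt; rewrite divr_gt0//; lra.
  - exact: near_c.
have -> : c + l *: d = l *: p + (1 - l) *: c.
  by apply/rowP => j; rewrite !mxE; ring.
rewrite /phi; have l01 : 0 <= l <= 1 by rewrite (ltW l0) ltW.
have hl := hconv p c l l01.
move: lX; rewrite ltr_pdivlMr; last lra.
move=> lX le_phi.
have : 0 <= l * (X + l * Y).
  apply: (@le_trans _ _ (l * h p + (1 - l) * h c - dotv v (l *: p + (1 - l) *: c) +
     lam / 2 * dotv (l *: p + (1 - l) *: c) (l *: p + (1 - l) *: c) -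
     (h c - dotv v c + lam / 2 * dotv c c))); first lra.
  by rewrite /X /Y /d !dotvE (dotvC p c) le_eqVlt; apply/orP; left; apply/eqP; field.
rewrite pmulr_rge0//; nra.
Unshelve. all: end_near. Qed.

End ConjugateEpigraph.

(** * Convergence of the epigraphs *)

Section ConjugateEpigraphConvergence.
Variables (R : realType) (n : nat).
Local Notation V := 'rV[R]_n.
Implicit Types (h : V -> R) (v p : V).

(** The epigraph of the conjugate as an intersection of closed half-spaces, free of extended-valued
    suprema: [a] stands for the affine minorant of [h] with slope [vpart a] and value [- etapart a]
    at 0. *)
Definition conj_epi h : set 'rV[R]_n.+1 :=
  [set a | forall p, dotv (vpart a) p - h p <= etapart a].

Lemma EsetE (H : R -> V -> V -> R) t x : Eset H t x = conj_epi (H t x).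
Proof.
apply/seteqP; split=> a /=.
  move=> Ha p; rewrite -lee_fin; apply: le_trans Ha.
  by apply: ereal_sup_ubound; exists p.
by move=> Ha; apply: ge_ereal_sup => _ [p _ <-]; rewrite lee_fin.
Qed.

(** [insub] fails only at the last index, which therefore receives [s]. *)
Definition epi_point v (s : R) : 'rV[R]_n.+1 :=
  \row_j oapp (fun k : 'I_n => v 0 k) s (insub (val j)).

Lemma vpart_epi_point v s : vpart (epi_point v s) = v.
Proof. by apply/rowP => k; rewrite !mxE /= valK. Qed.

Lemma etapart_epi_point v s : etapart (epi_point v s) = s.
Proof. by rewrite /etapart mxE insubF //= ltnn. Qed.

Lemma vpartB (a b : 'rV[R]_n.+1) : vpart (a - b) = vpart a - vpart b.
Proof. by apply/rowP => k; rewrite !mxE. Qed.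

Lemma norm_lt_parts (a : 'rV[R]_n.+1) (e : R) :
  enorm (vpart a) < e -> `|etapart a| < e -> `|a| < e.
Proof.
move=> ve se; rewrite [ltLHS]mx_normrE; apply/bigmax_ltP; split.
  exact: le_lt_trans (enorm_ge0 _) ve.
move=> [i j] _ /=; rewrite ord1; case: (ltnP j n) => jn; last first.
  by rewrite (_ : j = ord_max)//; apply/val_inj/eqP; rewrite eqn_leq jn -ltnS ltn_ord.
apply: le_lt_trans ve; apply: le_trans (norm_le_enorm _).
apply: le_trans (coord_le_norm _ (Ordinal jn)).
by rewrite mxE le_eqVlt; apply/orP; left; apply/eqP; congr (`|a 0 _|); exact: val_inj.
Qed.

Lemma cvg_vpart (T : Type) (F : set_system T) {FF : Filter F}
    (f : T -> 'rV[R]_n.+1) a :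
  f @ F --> a -> vpart (f z) @[z --> F] --> vpart a.
Proof.
move=> fa; apply: cvg_rV => j; rewrite [X in _ --> X]mxE.
rewrite (_ : (fun z => _) = fun z => f z 0 (widen_ord (leqnSn n) j)).
  exact: cvg_coord.
by apply/funext => z; rewrite mxE.
Qed.

Lemma convex_conj_epi h : convex_set (conj_epi h).
Proof.
move=> a b l ha hb /andP[l0 l1] p.
have -> : vpart (l *: a + (1 - l) *: b) = l *: vpart a + (1 - l) *: vpart b.
  by apply/rowP => k; rewrite !mxE.
have -> : etapart (l *: a + (1 - l) *: b) = l * etapart a + (1 - l) * etapart b.
  by rewrite /etapart !mxE.
rewrite !dotvE.
have : l * (dotv (vpart a) p - h p) <= l * etapart a by rewrite ler_wpM2l.
have : (1 - l) * (dotv (vpart b) p - h p) <= (1 - l) * etapart b.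
  by rewrite ler_wpM2l// subr_ge0.
lra.
Qed.

Lemma conj_epi_nonempty h : convex_fun h -> continuous h -> conj_epi h !=set0.
Proof.
move=> hconv hcont.
have K0 : (cball 0 1 : set V) !=set0.
  by exists 0; rewrite /cball /= subrr enorm0.
have [c _ cmin] := EVT_min_rV K0 (@compact_cball _ _ 0 1) (continuous_subspaceT hcont).
have {}cmin p : enorm p <= 1 -> h c <= h p.
  by move=> pr; apply: cmin; rewrite inE /cball /= subr0.
have hc0 : h c <= h 0 by rewrite cmin// enorm0.
(* With slope 0 and radius 1 the level [- h c] is valid on the unit ball, and half of [lam] exceeds
   [h 0 - h c] as required. *)
have [||||v [_ hv]] :=
    @minorant_near R n h 0 (- h c) 1 (2 * (h 0 - h c) + 1) hconv hcont.
- by [].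
- lra.
- by move=> p /cmin; rewrite dotvC dotv0; lra.
- by rewrite expr1n; lra.
exists (epi_point v (- h c)) => p.
by rewrite vpart_epi_point etapart_epi_point.
Qed.

(** The limit is taken jointly in the point and the index, so strict inequalities for [h] on a ball
    pass to [hs i] uniformly, by [near_in_compact]. *)
Lemma set_cvg_conj_epi (hs : nat -> V -> R) h :
  (forall i, convex_fun (hs i)) -> (forall i, continuous (hs i)) ->
  (forall p, hs z.2 z.1 @[z --> filter_prod (nbhs p) \oo] --> h p) ->
  set_cvg (fun i => conj_epi (hs i)) (conj_epi h).
Proof.
move=> hsconv hscont hsh.
have hsp p : hs i p @[i --> \oo] --> h p.
  have H : (p, i) @[i --> \oo] --> filter_prod (nbhs p) \oo.
    move=> S [[A B] /= [pA oB] AB]; apply: filterS oB => i Bi.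
    by apply: AB; split => //=; exact: nbhs_singleton.
  exact: (cvg_comp _ _ H (hsh p)).
split=> [y Ey U /nbhs_normP [e /= e0 eU]|y].
  pose v := vpart y; pose s := etapart y.
  have C0 : 0 <= h 0 + s.
    by have := Ey 0; rewrite dotv0 /s; lra.
  pose d := Num.min (e / 2) 1.
  have d0 : 0 < d by rewrite lt_min divr_gt0//=.
  have de : d <= e / 2 by rewrite ge_min lexx.
  have d1 : d <= 1 by rewrite ge_min lexx orbT.
  (* For large [i], [C] exceeds [hs i 0 + (s + d)], as [d <= 1]. The choice of [lam] bounds the
     squared change of slope by [2 * lam * C = d ^+ 2 / 2]; that of [r] gives [lam * r > 2 * C] and
     [r >= 1], hence the size condition of [minorant_near]. *)
  pose C := h 0 + s + 2.
  have Cp : 0 < C by rewrite /C; lra.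
  pose lam := d ^+ 2 / (4 * C).
  have lam0 : 0 < lam by rewrite divr_gt0 ?exprn_gt0// mulr_gt0.
  pose r := 2 * C / lam + 1.
  have r0 : 0 < r by rewrite addr_gt0// divr_gt0// mulr_gt0.
  have lamr : C < lam * r ^+ 2 / 2.
    have : lam * r = 2 * C + lam.
      by rewrite /r mulrDr mulr1 mulrCA divff ?mulr1// gt_eqF.
    have : 1 <= r by rewrite lerDr divr_ge0// ltW// mulr_gt0.
    by nra.
  have n0 : \forall i \near \oo, hs i 0 < h 0 + 1.
    by apply: (cvgr_lt _ (hsp 0)); rewrite ltrDl.
  have n1 : \forall i \near \oo, forall p, `|p - 0| <= r ->
      dotv v p - hs i p < s + d.
    apply: (@near_in_compact _ _ _ (fun i p => dotv v p - hs i p < s + d)).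
      exact: compact_ball.
    move=> p _.
    have : dotv v z.1 - hs z.2 z.1 @[z --> filter_prod (nbhs p) \oo] --> dotv v p - h p.
      apply: cvgB; last exact: hsh.
      by apply: cvg_dotv; [exact: cvg_cst|exact: cvg_fst].
    by move=> /cvgr_lt; apply; have := Ey p; rewrite -/v -/s; lra.
  apply: filterS2 n0 n1 => i hi0 hi1.
  have [||v' [v'v hv']] := @minorant_near R n (hs i) v (s + d) r lam
      (hsconv i) (hscont i) r0 lam0.
  - by move=> p pr; apply/ltW/hi1; rewrite subr0; apply: le_trans (norm_le_enorm _) pr.
  - by apply: lt_trans lamr; rewrite /C; lra.
  exists (epi_point v' (s + d)); split.
    by move=> p; rewrite vpart_epi_point etapart_epi_point.
  apply: eU => /=; rewrite distrC; apply: norm_lt_parts.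
    rewrite vpartB vpart_epi_point -/v; apply: le_lt_trans (_ : d < e); last lra.
    rewrite -(@ler_pXn2r _ 2)// ?nnegrE ?enorm_ge0 ?(ltW d0)// sqr_enorm.
    apply: le_trans v'v _.
    apply: (@le_trans _ _ (2 * lam * C)).
      apply: ler_wpM2l; first by rewrite mulr_ge0// ltW.
      by rewrite /C; move: hi0 d1; lra.
    rewrite (_ : 2 * lam * C = d ^+ 2 / 2); first by have := sqr_ge0 d; lra.
    by rewrite /lam; field; rewrite gt_eqF.
  rewrite (_ : etapart _ = d); first by rewrite gtr0_norm//; lra.
  have -> : etapart (epi_point v' (s + d) - y) = etapart (epi_point v' (s + d)) - s.
    by rewrite /s /etapart !mxE.
  by rewrite etapart_epi_point; lra.
(* A point outside strictly violates the half-space of some [p], and the violation persists for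
   nearby points and large [i]. *)
move=> /existsNP[p /negP]; rewrite -ltNge => yp.
have : (dotv (vpart z.1) p - hs z.2 p - etapart z.1)
    @[z --> filter_prod (nbhs y) \oo] --> dotv (vpart y) p - h p - etapart y.
  apply: cvgB; last by apply: cvg_coord; exact: cvg_fst.
  apply: cvgB; last exact: (cvg_comp _ _ cvg_snd (hsp p)).
  by apply: cvg_dotv; [apply: cvg_vpart; exact: cvg_fst|exact: cvg_cst].
move=> /cvgr_gt/(_ 0); rewrite subr_gt0 => /(_ yp).
by apply: filterS => z; rewrite subr_gt0 => zp /(_ p); rewrite leNgt zp.
Qed.

(** For a constant sequence the second half of [set_cvg] says that the complement is open. *)
Lemma closed_conj_epi h : convex_fun h -> continuous h -> closed (conj_epi h).
Proof.
move=> hconv hcont.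
have [_ H] : set_cvg (fun=> conj_epi h) (conj_epi h).
  apply: set_cvg_conj_epi => // p.
  apply: (@cvg_comp _ _ _ fst h _ (nbhs p)); [exact: cvg_fst|exact: hcont].
rewrite -openC openE => y /H [[A B] /= [yA oB] AB].
have [i Bi] : exists i, B i by exact: (filter_ex oB).
apply: filterS yA => z Az.
exact: (AB (z, i)).
Qed.

End ConjugateEpigraphConvergence.

(** * Iterated integrals and Steiner points *)

Section IteratedIntegral.
Variables (R : realType) (m : nat).
Local Notation V := 'rV[R]_m.
Local Notation mu := (@lebesgue_measure R).
Local Notation itv := (`[-1%R, 1%R]%classic : set R).
Implicit Types (D : set V) (Fs : nat -> V -> R) (F : V -> R) (x : V).

(** Continuous convergence off the exceptional set [D]; for a constant sequence of functions it is
    sequential continuity there. *)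
Definition cont_cvg D Fs F := forall x (xs : nat -> V),
  ~ D x -> xs @ \oo --> x -> Fs i (xs i) @[i --> \oo] --> F x.

Lemma cvg_upd (T : Type) (G : set_system T) {FG : Filter G} (f : T -> V) (g : T -> R) x k y :
  f @ G --> x -> g @ G --> y -> upd (f z) k (g z) @[z --> G] --> upd x k y.
Proof.
move=> fx gy; apply: cvg_rV => j.
rewrite [X in _ --> X]mxE (_ : (fun z => _) = fun z => if nat_of_ord j == k then g z else f z 0 j).
  by case: ifP => _ //; exact: cvg_coord.
by apply/funext => z; rewrite mxE.
Qed.

(** The line splits into [S], where all preimages are finite, and its open complement, where [g] is
    continuous. *)
Lemma measurable_off_finite (g : R -> R) (S : set R) : finite_set S ->
  (forall y (u : nat -> R), ~ S y -> u @ \oo --> y -> g (u i) @[i --> \oo] --> g y) ->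
  measurable_fun setT g.
Proof.
move=> fS gS.
have mfin A : finite_set A -> measurable (A : set R).
  move=> fA; apply: countable_measurable; last exact: finite_set_countable.
  by move=> t; exact: measurable_set1.
rewrite -(setUv S); apply/measurable_funU; first exact: mfin.
  by apply: measurableC; exact: mfin.
split.
  move=> _ Y mY; apply: mfin; apply: sub_finite_set fS.
  by move=> y [].
apply: measurable_realfun.open_continuous_measurable_fun.
  apply: closed_openC; apply: compact_closed; first exact: Rhausdorff.
  exact: finite_compact.
move=> y; rewrite inE => Sy; apply/(@cvg_nbhsP _ R^o) => u uy.
exact: gS.
Qed.

Lemma measure_itv_lty : (mu itv < +oo)%E.
Proof. by rewrite lebesgue_measure_itv /=; case: ifP => _; rewrite ?ltry. Qed.

Lemma integrable_cst_itv (B : R) : mu.-integrable itv (EFin \o cst B).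
Proof.
apply: measurable_bounded_integrable => //.
- exact: measure_itv_lty.
- exact: bounded_cst.
Qed.

Section Step.
Variables (Fs : nat -> V -> R) (F : V -> R) (D : set V) (k : nat) (B : R).
Hypothesis finD : forall x, finite_set [set y | D (upd x k y)].

Lemma integrable_section G x : (forall x, `|G x| <= B) -> cont_cvg D (fun=> G) G ->
  mu.-integrable itv (EFin \o (fun y => G (upd x k y))).
Proof.
move=> GB Gc; apply: measurable_bounded_integrable => //.
- exact: measure_itv_lty.
- apply: measurable_funTS; apply: measurable_off_finite (finD x) _ => y u Dy uy.
  by apply: Gc => //; apply: cvg_upd => //; exact: cvg_cst.
- exists B; split; first exact: num_real.
  by move=> M BM y _ /=; apply: le_trans (ltW BM).
Qed.

Lemma norm_integral_section G x : (forall x, `|G x| <= B) -> cont_cvg D (fun=> G) G ->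
  `|Rintegral mu itv (fun y => G (upd x k y))| <= Rintegral mu itv (cst B).
Proof.
move=> GB Gc; have iG := integrable_section x GB Gc.
apply: le_trans (le_normr_Rintegral _ iG) _ => //.
apply: le_Rintegral => //; last exact: integrable_cst_itv.
exact: integrable_norm iG.
Qed.

(** On the section through the limit [x] the exceptional [y] form a finite, hence null, set.
    Dominated convergence with constant bound [B] thus works at every [x], leaving no exceptional
    set. *)
Lemma cvg_integral_section : (forall i x, `|Fs i x| <= B) ->
  (forall i, cont_cvg D (fun=> Fs i) (Fs i)) -> cont_cvg D (fun=> F) F ->
  (forall x, `|F x| <= B) -> cont_cvg D Fs F ->
  cont_cvg set0 (fun i x => Rintegral mu itv (fun y => Fs i (upd x k y)))
                (fun x => Rintegral mu itv (fun y => F (upd x k y))).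
Proof.
move=> FsB Fsc Fc FB FsF x xs _ xsx.
have iF := integrable_section x FB Fc.
have := @dominated_convergence _ _ _ mu itv _
  (fun i => EFin \o (fun y => Fs i (upd (xs i) k y))) (EFin \o (fun y => F (upd x k y)))
  (EFin \o cst B).
case.
- by [].
- by move=> i; case/integrableP: (integrable_section (xs i) (FsB i) (Fsc i)).
- by case/integrableP: iF.
- exists [set y | D (upd x k y)]; split.
  + apply: countable_measurable; last exact: finite_set_countable.
    by move=> t; exact: measurable_set1.
  + by apply: countable_lebesgue_measure0; exact: finite_set_countable.
  move=> y /= ny; apply: contrapT => Dy; apply: ny => _.
  apply: cvg_EFin; first exact: nearW.
  by apply: FsF => //; apply: cvg_upd => //; exact: cvg_cst.
- exact: integrable_cst_itv.
- by apply: nearW => y i _ /=; rewrite lee_fin.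
move=> _ _ H; rewrite /Rintegral; apply: fine_cvg.
by rewrite fineK; [exact: H|exact: integrable_fin_num].
Qed.

End Step.

End IteratedIntegral.

(** * Averages over the sphere and Steiner points *)

Section SphereAverage.
Variables (R : realType).
Local Notation mu := (@lebesgue_measure R).
Local Notation itv := (`[-1%R, 1%R]%classic : set R).

(** The invariant carried from one integration of the iterated integral to the next. *)
Definition admissible m (D : set 'rV[R]_m) (Fs : nat -> 'rV[R]_m -> R) F B :=
  [/\ forall i x, `|Fs i x| <= B, forall x, `|F x| <= B,
      forall i, cont_cvg D (fun=> Fs i) (Fs i),
      cont_cvg D (fun=> F) F & cont_cvg D Fs F].

Lemma admissible_integral m (D : set 'rV[R]_m) Fs F B k :
  (forall x, finite_set [set y | D (upd x k y)]) -> admissible D Fs F B ->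
  admissible set0 (fun i x => Rintegral mu itv (fun y => Fs i (upd x k y)))
    (fun x => Rintegral mu itv (fun y => F (upd x k y))) (Rintegral mu itv (cst B)).
Proof.
move=> finD [FsB FB Fsc Fc FsF]; split.
- by move=> i x; exact: norm_integral_section.
- by move=> x; exact: norm_integral_section.
- by move=> i; exact: (@cvg_integral_section _ _ (fun=> Fs i) (Fs i) D k B).
- exact: (@cvg_integral_section _ _ (fun=> F) F D k B).
- exact: (@cvg_integral_section _ _ Fs F D k B).
Qed.

(** [iterint] integrates coordinate 0 innermost, so [D] is met only along lines in that direction;
    every later step has an empty exceptional set. *)
Lemma admissible_iterint m (D : set 'rV[R]_m) Fs F B k :
  (forall x, finite_set [set y | D (upd x 0 y)]) -> admissible D Fs F B ->
  exists B', admissible set0 (fun i => iterint k.+1 (Fs i)) (iterint k.+1 F) B'.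
Proof.
move=> finD FsF; elim: k => [|k [B' IH]].
  by exists (Rintegral mu itv (cst B)); exact: admissible_integral FsF.
exists (Rintegral mu itv (cst B')); apply: admissible_integral IH => x.
exact: finite_set0.
Qed.

Lemma cvg_cube_int n (D : set 'rV[R]_n.+1) Fs F B :
  (forall x, finite_set [set y | D (upd x 0 y)]) -> admissible D Fs F B ->
  cube_int (Fs i) @[i --> \oo] --> cube_int F.
Proof.
move=> finD FsF; have [B' [_ _ _ _ H]] := admissible_iterint n finD FsF.
exact: (H 0 (fun=> 0) _ (cvg_cst _)).
Qed.

(** The integrand in the numerator of [sphere_avg]. *)
Definition radial_cut m (g : 'rV[R]_m -> R) (x : 'rV[R]_m) : R :=
  if (0 < enorm x) && (enorm x <= 1) then g ((enorm x)^-1 *: x) else 0.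

Definition radial_jumps m : set 'rV[R]_m := [set x | enorm x = 0 \/ enorm x = 1].

(** Along the line the squared norm is [y ^+ 2 + c], so each of the two levels is reached at most
    twice. *)
Lemma finite_radial_jumps n (x : 'rV[R]_n.+1) :
  finite_set [set y | @radial_jumps n.+1 (upd x 0 y)].
Proof.
pose c := \sum_(j < n) x 0 (lift ord0 j) * x 0 (lift ord0 j).
have sq y : enorm (upd x 0 y) ^+ 2 = y ^+ 2 + c.
  rewrite sqr_enorm /dotv big_ord_recl !mxE /= -expr2; congr (_ + _).
  by apply: eq_bigr => j _; rewrite !mxE.
have fin s : finite_set [set y : R | y ^+ 2 = s].
  apply: (@sub_finite_set _ _ [set Num.sqrt s; - Num.sqrt s]) => [y /= ys|].
    have : y ^+ 2 = Num.sqrt s ^+ 2 by rewrite sqr_sqrtr// -ys sqr_ge0.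
    by move/eqP; rewrite eqf_sqr => /orP[/eqP|/eqP]; [left|right].
  exact: finite_set2.
have : finite_set ([set y : R | y ^+ 2 = - c] `|` [set y : R | y ^+ 2 = 1 - c]).
  by rewrite finite_setU; split; exact: fin.
apply: sub_finite_set => y /= [] e; have := sq y; rewrite e => h; [left|right];
  by move: h; rewrite /= ?expr1n ?expr0n /=; lra.
Qed.

Lemma enorm_normalize m (x : 'rV[R]_m) : 0 < enorm x -> enorm ((enorm x)^-1 *: x) = 1.
Proof.
move=> x0; rewrite enormZ gtr0_norm ?invr_gt0// mulVf// gt_eqF//.
Qed.

(** Off the jumps, the norm of [x] is strictly between 0 and 1 or strictly above 1, and that of
    [xs i] eventually is in the same range. *)
Lemma cont_cvg_radial_cut m (gs : nat -> 'rV[R]_m -> R) g :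
  cont_cvg set0 gs g ->
  cont_cvg (@radial_jumps m) (fun i => radial_cut (gs i)) (radial_cut g).
Proof.
move=> gsg x xs /not_orP[x0 x1] xsx.
have ex : enorm (xs i) @[i --> \oo] --> enorm x by exact: cvg_enorm.
have xp : 0 < enorm x by rewrite lt0r enorm_ge0 andbT; apply/eqP.
rewrite /radial_cut xp /=; have [xl|xl] := leP (enorm x) 1; last first.
  have gt1 : \forall i \near \oo, 1 < enorm (xs i) by exact: (cvgr_gt _ ex).
  apply: cvg_near_cst; apply: filterS gt1 => i xi.
  by rewrite [_ <= 1]leNgt xi andbF.
have {}xl : enorm x < 1 by rewrite lt_neqAle xl andbT; apply/eqP.
have near_eq : \forall i \near \oo, gs i ((enorm (xs i))^-1 *: xs i) = radial_cut (gs i) (xs i).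
  have gt0 : \forall i \near \oo, 0 < enorm (xs i) by exact: (cvgr_gt _ ex).
  have lt1 : \forall i \near \oo, enorm (xs i) < 1 by exact: (cvgr_lt _ ex).
  apply: filterS2 gt0 lt1 => i i0 i1.
  by rewrite /radial_cut i0 ltW.
apply: cvg_trans (near_eq_cvg near_eq) _.
apply: gsg => //; apply: cvgZ => //.
by apply: cvgV => //; rewrite gt_eqF.
Qed.

(** [radial_cut] evaluates its function only at unit vectors, so bounds on the sphere bound the
    integrands on the whole cube. *)
Lemma cvg_sphere_avg n (gs : nat -> 'rV[R]_n.+1 -> R) g B : 0 <= B ->
  (forall i p, enorm p = 1 -> `|gs i p| <= B) ->
  (forall p, enorm p = 1 -> `|g p| <= B) ->
  (forall i, cont_cvg set0 (fun=> gs i) (gs i)) ->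
  cont_cvg set0 (fun=> g) g -> cont_cvg set0 gs g ->
  sphere_avg (gs i) @[i --> \oo] --> sphere_avg g.
Proof.
move=> B0 gsB gB gsc gc gsg.
have cutB (f : 'rV[R]_n.+1 -> R) x : (forall p, enorm p = 1 -> `|f p| <= B) ->
    `|radial_cut f x| <= B.
  move=> fB; rewrite /radial_cut; case: ifP => [/andP[x0 _]|_].
    by apply: fB; exact: enorm_normalize.
  by rewrite normr0.
apply: cvgM; last exact: cvg_cst.
apply: (@cvg_cube_int _ (@radial_jumps n.+1) (fun i => radial_cut (gs i)) (radial_cut g) B).
  exact: finite_radial_jumps.
split.
- by move=> i x; apply: cutB; exact: gsB.
- by move=> x; exact: cutB.
- by move=> i; exact: cont_cvg_radial_cut.
- exact: cont_cvg_radial_cut.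
- exact: cont_cvg_radial_cut.
Qed.

Lemma cvg_steiner n (Ks : nat -> set 'rV[R]_n.+1) K B :
  (forall i, closed (Ks i)) -> closed K -> (forall i, Ks i !=set0) -> K !=set0 ->
  (forall i y, Ks i y -> `|y| <= B) -> (forall y, K y -> `|y| <= B) ->
  set_cvg Ks K -> steiner (Ks i) @[i --> \oo] --> steiner K.
Proof.
move=> Ksc Kc Ks0 K0 KsB KB KsK.
have B0 : 0 <= B by move: K0 => [y /KB]; exact: le_trans.
apply: cvg_rV => j; rewrite [X in _ --> X]mxE.
rewrite (_ : (fun i => _) =
  fun i => n.+1%:R * sphere_avg (fun p => p 0 j * supp_fun (Ks i) p)); last first.
  by apply/funext => i; rewrite mxE.
apply: cvgM; first exact: cvg_cst.
pose C := n.+1%:R * B.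
have C0 : 0 <= C by rewrite mulr_ge0.
have sB A p : (forall y, A y -> `|y| <= B) -> enorm p = 1 ->
    `|p 0 j * supp_fun A p| <= C.
  move=> AB p1; have pn : `|p| <= 1 by rewrite -p1 norm_le_enorm.
  rewrite normrM -[leRHS]mul1r; apply: ler_pM => //.
    exact: le_trans (coord_le_norm _ _) pn.
  apply: le_trans (norm_supp_fun p B0 AB) _.
  by rewrite ler_wpM2l// -[leRHS]mul1r ler_wpM2r.
(* Used for the sequence itself and, through constant sequences, for the continuity in [p] of each
   single integrand. *)
have main As A : (forall i y, As i y -> `|y| <= B) -> (forall y, A y -> `|y| <= B) ->
    set_cvg As A -> A !=set0 ->
    cont_cvg set0 (fun i p => p 0 j * supp_fun (As i) p) (fun p => p 0 j * supp_fun A p).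
  move=> AsB AB AsA A0 p ps _ psp; apply: cvgM; first exact: cvg_coord.
  exact: (cvg_supp_fun AsA A0 AsB AB).
apply: (@cvg_sphere_avg n _ _ C C0).
- by move=> i p; apply: sB; exact: KsB.
- by move=> p; exact: sB.
- move=> i; apply: (main (fun=> Ks i)) => //; [by move=> _; exact: KsB|exact: KsB|].
  exact: set_cvg_cst.
- by apply: (main (fun=> K)) => //; exact: set_cvg_cst.
- exact: main.
Qed.

End SphereAverage.

(** * Convergence of the selections *)

Section HamiltonianConvergence.
Variables (R : realType) (n : nat) (T : R).
Local Notation V := 'rV[R]_n.
Local Notation dom := [set z : R * V * V | z.1.1 \in `[0, T]].
Local Notation uncurried h := (fun z : R * V * V => h z.1.1 z.1.2 z.2).

Lemma cvg_within_comp (Z W : topologicalType) (A : set Z) (f : Z -> W)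
    (S : Type) (G : set_system S) {FG : Filter G} (u : S -> Z) z :
  {within A, continuous f} -> A z -> (forall s, A (u s)) -> u @ G --> z ->
  f (u s) @[s --> G] --> f z.
Proof.
move=> /subspace_continuousP fc Az Au uz P fP.
have : \forall s \near G, A (u s) -> P (f (u s)) by exact: (uz _ (fc z Az P fP)).
by apply: filterS => s; apply; exact: Au.
Qed.

Variable H : nat -> R -> V -> V -> R.
Hypothesis Hcont : forall i, {within dom, continuous (uncurried (H i))}.

Lemma continuous_hamiltonian i t x : t \in `[0, T] -> continuous (H i t x).
Proof.
move=> tT p.
have tp : ((t, x), p') @[p' --> p] --> ((t, x), p).
  exact: (@cvg_pair _ _ _ (nbhs p) (nbhs (t, x)) (nbhs p) _ _ _ (fun=> (t, x)) id
    (cvg_cst _) cvg_id).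
have /= := @cvg_within_comp _ _ dom _ _ (nbhs p) _ (fun p' => (t, x, p')) (t, x, p)
  (@Hcont i) tT (fun=> tT) tp.
exact.
Qed.

Hypothesis Hunif : forall K : set (R * V * V), compact K -> K `<=` dom ->
  forall eps : R, 0 < eps -> \forall i \near \oo, forall z, K z ->
    `|uncurried (H i) z - uncurried (H 0%N) z| < eps.

(** Compare through [H 0%N] at the moving point: continuity of [H 0%N] controls one difference, and
    uniform convergence on a compact product of [[0, T]] with unit balls around [x0] and [p]
    controls the other. *)
Lemma cvg_hamiltonian (t : nat -> R) (x : nat -> V) t0 x0 p :
  t0 \in `[0, T] -> (forall i, t i \in `[0, T]) ->
  t @ \oo --> t0 -> x @ \oo --> x0 ->
  H z.2 (t z.2) (x z.2) z.1 @[z --> filter_prod (nbhs p) \oo] --> H 0%N t0 x0 p.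
Proof.
move=> t0T tT tt0 xx0; apply/cvgrPdist_lt => e e0.
have e20 : 0 < e / 2 by rewrite divr_gt0.
pose K : set (R * V * V) :=
  (`[0, T]%classic `*` [set y : V | `|y - x0| <= 1]) `*` [set y : V | `|y - p| <= 1].
have cK : compact K.
  by do 2?apply: compact_setX; [exact: segment_compact|exact: compact_ball|exact: compact_ball].
have KT : K `<=` dom by move=> z [[]].
have tp : ((t z.2, x z.2), z.1) @[z --> filter_prod (nbhs p) \oo] --> ((t0, x0), p).
  have tx : (t z.2, x z.2) @[z --> filter_prod (nbhs p) \oo] --> (t0, x0).
    exact: (@cvg_pair _ _ _ _ (nbhs t0) (nbhs x0) _ _ _ (fun z => t z.2) (fun z => x z.2)
      (cvg_comp _ _ cvg_snd tt0) (cvg_comp _ _ cvg_snd xx0)).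
  exact: (@cvg_pair _ _ _ _ (nbhs (t0, x0)) (nbhs p) _ _ _
    (fun z => (t z.2, x z.2)) fst tx cvg_fst).
have c0 : H 0%N (t z.2) (x z.2) z.1 @[z --> filter_prod (nbhs p) \oo] --> H 0%N t0 x0 p.
  exact: (@cvg_within_comp _ _ dom _ _ _ _
    (fun z => (t z.2, x z.2, z.1)) (t0, x0, p)
    (@Hcont 0%N) t0T (fun z => tT z.2) tp).
have n1 : \forall z \near filter_prod (nbhs p) \oo,
    `|H 0%N t0 x0 p - H 0%N (t z.2) (x z.2) z.1| < e / 2 by exact: cvgr_dist_lt.
have n2 : \forall z \near filter_prod (nbhs p) \oo, forall w, K w ->
    `|uncurried (H z.2) w - uncurried (H 0%N) w| < e / 2.
  exact: (cvg_snd (Hunif cK KT e20)).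
have n3 : \forall z \near filter_prod (nbhs p) \oo, `|x0 - x z.2| < 1.
  have x1 : \forall i \near \oo, `|x0 - x i| < 1 by exact: cvgr_dist_lt.
  exact: (cvg_snd x1).
have n4 : \forall z \near filter_prod (nbhs p) \oo, `|p - z.1| < 1.
  by apply: cvgr_dist_lt => //; exact: cvg_fst.
near=> z.
have Kz : K ((t z.2, x z.2), z.1).
  split=> /=; last by rewrite distrC ltW//; near: z.
  by split=> /=; [exact: tT|rewrite distrC ltW//; near: z].
have h1 : `|H z.2 (t z.2) (x z.2) z.1 - H 0%N (t z.2) (x z.2) z.1| < e / 2.
  have HK : forall w, K w -> `|uncurried (H z.2) w - uncurried (H 0%N) w| < e / 2.
    by near: z.
  exact: (HK _ Kz).
have h2 : `|H 0%N t0 x0 p - H 0%N (t z.2) (x z.2) z.1| < e / 2 by near: z.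
apply: le_lt_trans (ler_distD (H 0%N (t z.2) (x z.2) z.1) _ _) _.
by rewrite [ltRHS]splitr ltrD// distrC.
Unshelve. all: end_near. Qed.

End HamiltonianConvergence.

Lemma cvg_steiner_near_part (R : realType) (n : nat) (Ks : nat -> set 'rV[R]_n.+1) K
    (a_ : nat -> 'rV[R]_n.+1) a :
  (forall i, closed (Ks i)) -> closed K -> (forall i, Ks i !=set0) -> K !=set0 ->
  convex_set K -> set_cvg Ks K -> a_ @ \oo --> a ->
  steiner (near_part (Ks i) (a_ i)) @[i --> \oo] --> steiner (near_part K a).
Proof.
move=> Ksc Kc Ks0 K0 Kconv KsK aa.
(* A bound for the truncation of index [i]; being convergent, [c] is bounded, so all truncations
   share one ball. *)
pose c i := 2 * dist (a_ i) (Ks i) + `|a_ i|.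
have near_partB A b y : near_part A b y -> `|y| <= 2 * dist b A + `|b|.
  move=> [_ yb]; rewrite -{1}(subrK b y).
  apply: le_trans (ler_normD _ _) _; rewrite lerD2r.
  exact: le_trans (norm_le_enorm _) yb.
have cc : c i @[i --> \oo] --> 2 * dist a K + `|a|.
  apply: cvgD; last exact: cvg_norm.
  by apply: cvgM; [exact: cvg_cst|exact: cvg_dist].
have [M Mc] : exists M, forall i, c i <= M.
  have /cvg_seq_bounded [M [_ Mc]] : cvgn c by apply/cvg_ex; exists (2 * dist a K + `|a|).
  exists (M + 1) => i; apply: le_trans (ler_norm _) _.
  by apply: Mc => //; rewrite ltrDl.
apply: (@cvg_steiner R n _ _ (Num.max M (2 * dist a K + `|a|))).
- by move=> i; apply: closedI; [exact: Ksc|exact: closed_cball].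
- by apply: closedI; [exact: Kc|exact: closed_cball].
- by move=> i; exact: near_part_nonempty.
- exact: near_part_nonempty.
- by move=> i y /near_partB yB; rewrite le_max; apply/orP; left; exact: le_trans yB (Mc i).
- by move=> y /near_partB yB; rewrite le_max yB orbT.
- exact: set_cvg_near_part.
Qed.

Unset Implicit Arguments.
Set Strict Implicit.

Theorem theorem5p15 (R : realType) (n : nat) (T : R)
  (H : nat -> R -> 'rV[R]_n -> 'rV[R]_n -> R) :
  (* continuity in all variables on [0,T] x R^n x R^n *)
  (forall i, {within [set z : R * 'rV[R]_n * 'rV[R]_n | z.1.1 \in `[0, T]],
               continuous (fun z : R * 'rV[R]_n * 'rV[R]_n => H i z.1.1 z.1.2 z.2)}) ->
  (* convexity in the last variable *)
  (forall i t x (p q : 'rV[R]_n) (l : R), t \in `[0, T] -> 0 <= l <= 1 ->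
     H i t x (l *: p + (1 - l) *: q) <= l * H i t x p + (1 - l) * H i t x q) ->
  (* H_i -> H_0 uniformly on compact subsets of [0,T] x R^n x R^n *)
  (forall K : set (R * 'rV[R]_n * 'rV[R]_n), compact K ->
     K `<=` [set z | z.1.1 \in `[0, T]] ->
     forall eps : R, 0 < eps ->
       \forall i \near \oo, forall z, K z ->
         `|H i z.1.1 z.1.2 z.2 - H 0%N z.1.1 z.1.2 z.2| < eps) ->
  forall (t0 : R) (x0 : 'rV[R]_n) (a0 : 'rV[R]_n.+1)
         (t : nat -> R) (x : nat -> 'rV[R]_n) (a : nat -> 'rV[R]_n.+1),
  t0 \in `[0, T] -> (forall i, t i \in `[0, T]) ->
  t i @[i --> \oo] --> t0 -> x i @[i --> \oo] --> x0 -> a i @[i --> \oo] --> a0 ->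
  esel (H i) (t i) (x i) (a i) @[i --> \oo] --> esel (H 0%N) t0 x0 a0.
Proof.
move=> Hcont Hconv Hunif t0 x0 a0 t x a t0T tT tt0 xx0 aa0.
have hconv i s y : s \in `[0, T] -> convex_fun (H i s y).
  by move=> sT p q l l01; exact: Hconv.
have hcont i s y : s \in `[0, T] -> continuous (H i s y).
  exact: continuous_hamiltonian.
rewrite /esel /Phi EsetE.
rewrite (_ : (fun i => _) =
  fun i => steiner (near_part (conj_epi (H i (t i) (x i))) (a i))); last first.
  by apply/funext => i; rewrite EsetE.
apply: cvg_steiner_near_part => //.
- by move=> i; apply: closed_conj_epi; [exact: hconv|exact: hcont].
- by apply: closed_conj_epi; [exact: hconv|exact: hcont].
- by move=> i; apply: conj_epi_nonempty; [exact: hconv|exact: hcont].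
- by apply: conj_epi_nonempty; [exact: hconv|exact: hcont].
- exact: convex_conj_epi.
apply: set_cvg_conj_epi => [i|i|p]; [exact: hconv|exact: hcont|].
exact: (@cvg_hamiltonian R n T H Hcont Hunif t x t0 x0 p t0T tT tt0 xx0).
Qed.
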